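(* Let $\mathcal C$ be a finite closure system on a finite set $X$, represented by a normalized implicational basis $\Gamma$ written in singleton-conclusion form, so that $\mathcal C=\operatorname{Mod}(\Gamma)$. One can construct a normalized hypergraph $\mathcal H$ of rank at most three, on a ground set $V(\mathcal H)$, such that $$\mathcal C\cong \operatorname{Mod}(\Phi_{\mathcal H})\setminus\{V(\mathcal H)\}$$ as posets under inclusion. Moreover, $L(\mathcal H)=O(\|\Gamma\|_{\mathrm{inc}})$. Consequently, every finite lattice is isomorphic, as a poset, to the proper-model poset $\operatorname{Mod}(\Phi_{\mathcal H})\setminus\{V(\mathcal H)\}$ (ordered by inclusion) of a hypergraph Horn function $\Phi_{\mathcal H}$ with $\operatorname{rank}(\mathcal H)\le 3$.
   Context: A closure system on a finite set $X$ is a family of subsets of $X$ that contains $X$ and is closed under intersection. A normalized implicational basis in singleton-conclusion form on $X$ is a finite set $\Gamma$ (no duplicates) of definite implications $A\to b$ with $A\subseteq X$ (possibly empty) and $b\in X\setminus A$; $\operatorname{Mod}(\Gamma)$ is the family of $M\subseteq X$ such that for every $A\to b\in\Gamma$, $A\subseteq M$ implies $b\in M$. Its incidence length is $\|\Gamma\|_{\mathrm{inc}}=|X|+|\Gamma|+\sum_{A\to b\in\Gamma}(|A|+1)$. A hypergraph on a finite set $V=V(\mathcal H)$ is a family $\mathcal H\subseteq 2^V$; it is normalized if it has no duplicate and no empty hyperedges. Put $L(\mathcal H)=|V|+|\mathcal H|+\sum_{A\in\mathcal H}|A|$ and $\operatorname{rank}(\mathcal H)=\max_{A\in\mathcal H}|A|$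 (zero if $\mathcal H$ is empty). The associated hypergraph Horn function is given by the definite Horn CNF $$\Phi_{\mathcal H}=\bigwedge_{A\in\mathcal H}\bigwedge_{v\in A}\bigl((A\setminus\{v\})\to v\bigr),$$ and $\operatorname{Mod}(\Phi_{\mathcal H})\subseteq 2^V$ is its family of models (sets of true variables). It always contains $V$. *)

(* Defs.v *)
From mathcomp Require Import all_boot all_order.

Set Implicit Arguments.
Unset Strict Implicit.
Unset Printing Implicit Defensive.

(* The ground set X is a finType, and [set: X] plays the role of X. *)
Definition closure_system (X : finType) (C : {set {set X}}) : Prop :=
  [set: X] \in C /\ {in C &, forall A B : {set X}, A :&: B \in C}.

(* (A, b) stands for the definite implication A -> b. *)
Definition implication (X : finType) : Type := ({set X} * X)%type.

(* A set of implications has no duplicates, so only b \notin A is left. *)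
Definition normalized_basis (X : finType) (G : {set implication X}) : Prop :=
  {in G, forall i : implication X, i.2 \notin i.1}.

Definition models (X : finType) (G : {set implication X}) : {set {set X}} :=
  [set M : {set X} | [forall i in G, (i.1 \subset M) ==> (i.2 \in M)]].

Definition incidence_length (X : finType) (G : {set implication X}) : nat :=
  #|X| + #|G| + \sum_(i in G) (#|i.1| + 1).

(* A hypergraph on V is a set H : {set {set V}}; duplicate hyperedges cannot
   occur. *)
Definition normalized_hypergraph (V : finType) (H : {set {set V}}) : Prop :=
  set0 \notin H.

Definition hypergraph_length (V : finType) (H : {set {set V}}) : nat :=
  #|V| + #|H| + \sum_(A in H) #|A|.

Definition hypergraph_rank (V : finType) (H : {set {set V}}) : nat :=
  \max_(A in H) #|A|.

(* The definite Horn CNF Phi_H, as its set of clauses. *)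
Definition horn_cnf (V : finType) (H : {set {set V}}) : {set implication V} :=
  [set (A :\ v, v) | A in H, v in A].

Definition proper_models (V : finType) (H : {set {set V}}) : {set {set V}} :=
  models (horn_cnf H) :\ [set: V].

Definition members (X : finType) (F : {set {set X}}) : Type :=
  {S : {set X} | S \in F}.

Definition inclusion (X : finType) (F : {set {set X}}) : rel (members F) :=
  fun S T => val S \subset val T.

Definition poset_isomorphic (P Q : Type) (leP : rel P) (leQ : rel Q) : Prop :=
  exists2 f : P -> Q, bijective f & {mono f : x y / leP x y >-> leQ x y}.

(* Main.v *)
Require Import Defs.
From mathcomp Require Import all_boot all_order.
From mathcomp Require Import zify.

Set Implicit Arguments.
Unset Strict Implicit.
Unset Printing Implicit Defensive.

(** A hyperedge A says that a model never misses exactly one vertex of A.  This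
    condition is symmetric in the vertices, so the point is to get one-way
    implications out of it with edges of size three.  The trick is to double
    every vertex u into twins u0, u1 joined by an edge {u0, u1}: a model
    contains both twins or none, and then the edge {u0, u1, w0} says precisely
    that u implies w ([arrow]).  Likewise, once c implies a and b, the edge
    {a0, b0, c1} says that c is the conjunction of a and b ([meet_edge]).

    Given a basis G, the doubled vertices are named by subsets T of X, with the
    intended meaning that T is contained in the set S which the model encodes.
    The names are the empty set, the singletons, and, for each premise A, the
    sets obtained by deleting the elements of A one at a time.  Each nonempty
    name T is the conjunction of a smaller name T \ a and of the singleton {a},
    so a model is determined by the singletons that it contains
    ([mem_node_model]); the conclusion b of a premise A is imposed by
    an arrow from A to {b}.  One more vertex implies all others.  The only model
    that contains it is the full vertex set, which is thereby kept apart from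
    the model that encodes S = X.  Every premise A uses |A| + 1 names, and every
    name uses boundedly many edges, whence the linear size.

    For a finite lattice, the principal ideals form a closure system ordered
    like the lattice, and a closure system has as a basis the set of all
    implications valid in it. *)

(** * Isomorphic posets *)

Lemma poset_isomorphic_trans (P Q R : Type) (leP : rel P) (leQ : rel Q)
    (leR : rel R) :
  poset_isomorphic leP leQ -> poset_isomorphic leQ leR ->
  poset_isomorphic leP leR.
Proof.
move=> [f fbij fmono] [g gbij gmono]; exists (g \o f); first exact: bij_comp.
by move=> x y /=; rewrite gmono fmono.
Qed.

(** Inverse bijections are given on all subsets, so that no dependent pairs
    have to be handled when the lemma is used. *)
Lemma members_isomorphic (X Y : finType) (C : {set {set X}})
    (D : {set {set Y}}) (f : {set X} -> {set Y}) (g : {set Y} -> {set X}) :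
  {in C, forall S, f S \in D} -> {in D, forall M, g M \in C} ->
  {in C, cancel f g} -> {in D, cancel g f} ->
  {in C &, {mono f : S T / S \subset T}} ->
  poset_isomorphic (@inclusion X C) (@inclusion Y D).
Proof.
move=> fD gC fK gK fmono.
pose F (S : members C) : members D := exist _ (f (val S)) (fD _ (valP S)).
pose K (M : members D) : members C := exist _ (g (val M)) (gC _ (valP M)).
exists F; last by move=> S T; apply: fmono; apply: valP.
exists K => [S|M]; apply: val_inj; first exact: fK (valP S).
exact: gK (valP M).
Qed.

(** * Models of a hypergraph Horn function *)

Lemma horn_modelsP (V : finType) (H : {set {set V}}) (M : {set V}) :
  reflect {in H, forall A : {set V},
             {in A, forall v, A :\ v \subset M -> v \in M}}
          (M \in models (horn_cnf H)).
Proof.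
rewrite inE; apply: (iffP forall_inP) => [mod A HA v Av AM | mod i].
  by move/implyP: (mod (A :\ v, v) (imset2_f _ HA Av)); apply.
by case/imset2P=> A v HA Av -> /=; apply/implyP; apply: mod.
Qed.

Section DoubledVertices.

Variable U : finType.
Implicit Types (u w a b c : U) (M : {set U * bool}).

Definition arrow u w : {set U * bool} :=
  [set (u, false); (u, true); (w, false)].

(** The twin on the third vertex keeps the edge harmless when c coincides with
    a or b: untwinned, the edge for c = a would make b imply a. *)
Definition meet_edge a b c : {set U * bool} :=
  [set (a, false); (b, false); (c, true)].

Definition doubled (p : pred U) : {set U * bool} := [set v | p v.1].

(** After the deletion of v, at least one twin of u remains. *)
Lemma doubled_arrow (p : pred U) u w v :
  (p u -> p w) -> v \in arrow u w -> arrow u w :\ v \subset doubled p ->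
  v \in doubled p.
Proof.
move=> puw vuw /subsetP sub; rewrite inE.
have pu : p u.
  have := sub (u, v != (u, true)); rewrite !inE; apply.
  case: (eqVneq v (u, true)) => [-> | neq] /=.
    by rewrite !xpair_eqE !eqxx.
  by rewrite eq_sym neq eqxx orbT.
by move: vuw; rewrite !inE => /orP[/orP[]|] /eqP-> //=; apply: puw.
Qed.

Lemma doubled_meet_edge (p : pred U) a b c v :
  p c = p a && p b -> v \in meet_edge a b c ->
  meet_edge a b c :\ v \subset doubled p -> v \in doubled p.
Proof.
move=> pc vE /subsetP sub; rewrite inE.
have pcP : v.2 = false -> p c.
  move=> v0; have := sub (c, true); rewrite !inE !eqxx orbT andbT /=; apply.
  by apply: contraFneq v0 => <-.
move: vE; rewrite !inE => /orP[/orP[]|] /eqP Dv; move: pcP; rewrite Dv /=.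
- by rewrite pc => /(_ erefl)/andP[].
- by rewrite pc => /(_ erefl)/andP[].
move=> _; have := sub (a, false); have := sub (b, false).
by rewrite pc !inE Dv !xpair_eqE !eqxx !andbF /= orbT /= => -> // ->.
Qed.

Variables (H : {set {set U * bool}}) (M : {set U * bool}).
Hypothesis modM : M \in models (horn_cnf H).

Lemma arrow_model u w :
  arrow u w \in H -> (u, false) \in M -> (u, true) \in M -> (w, false) \in M.
Proof.
move=> Huw u0 u1; apply: (horn_modelsP _ _ modM _ Huw).
  by rewrite !inE eqxx !orbT.
apply/subsetP=> v; rewrite !inE => /andP[/negPf->].
by rewrite orbF => /pred2P[]->.
Qed.

Lemma twins_model u :
  arrow u u \in H -> ((u, true) \in M) = ((u, false) \in M).
Proof.
move=> Hu; have mod := horn_modelsP _ _ modM _ Hu.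
by apply/idP/idP=> uM; apply: mod; rewrite ?inE ?eqxx ?orbT //;
  apply/subsetP=> v; rewrite !inE => /andP[/negPf->];
  rewrite ?orbF ?orbb => /eqP->.
Qed.

Lemma meet_edge_model a b c :
  meet_edge a b c \in H -> (a, false) \in M -> (b, false) \in M ->
  (c, true) \in M.
Proof.
move=> Habc a0 b0; apply: (horn_modelsP _ _ modM _ Habc).
  by rewrite !inE eqxx !orbT.
apply/subsetP=> v; rewrite !inE => /andP[/negPf->].
by rewrite orbF => /pred2P[]->.
Qed.

End DoubledVertices.

(** * The hypergraph of an implicational basis *)

Section Encoding.

Variable X : finType.
Implicit Types (S T A : {set X}).

Definition shrink T := if [pick a in T] is Some a then T :\ a else T.

(** Empty when T is, and otherwise the singleton of the element that [shrink]
    deletes; in both cases T is the union of [shrink T] and [residue T]. *)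
Definition residue T := T :\: shrink T.

Lemma shrink_sub T : shrink T \subset T.
Proof. by rewrite /shrink; case: pickP => // a _; apply: subsetDl. Qed.

Lemma shrinkU_residue T : shrink T :|: residue T = T.
Proof.
by rewrite /residue setDE setUIr setUCr setIT; apply/setUidPr/shrink_sub.
Qed.

Lemma card_shrink T : #|shrink T| = #|T|.-1.
Proof.
rewrite /shrink; case: pickP => [a aT | T0]; first by rewrite (cardsD1 a T) aT.
by rewrite (eq_card0 T0).
Qed.

Lemma residueP T : residue T = set0 \/ exists x, residue T = [set x].
Proof.
have: #|residue T| <= 1.
  rewrite cardsD (setIidPr (shrink_sub T)) card_shrink.
  by case: #|T| => // n; rewrite subSnn.
case: (posnP #|residue T|) => [/eqP|c_gt0 c_le1].
  by rewrite cards_eq0 => /eqP; left.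
by right; apply/cards1P; rewrite eqn_leq c_le1.
Qed.

Definition chain A : {set {set X}} := [set iter k shrink A | k : 'I_#|A|.+1].

Definition names (G : {set implication X}) : {set {set X}} :=
  set0 |: [set [set x] | x : X] :|: \bigcup_(i in G) chain i.1.

Variable G : {set implication X}.

Lemma names0 : set0 \in names G.
Proof. by rewrite !inE eqxx. Qed.

Lemma names1 x : [set x] \in names G.
Proof. by rewrite !inE imset_f ?orbT. Qed.

Lemma names_premise i : i \in G -> i.1 \in names G.
Proof.
move=> Gi; rewrite inE; apply/orP; right; apply/bigcupP; exists i => //.
by apply/imsetP; exists ord0.
Qed.

Lemma names_residue T : residue T \in names G.
Proof. by case: (residueP T) => [|[x]] ->; [apply: names0 | apply: names1]. Qed.

(** A chain ends with the empty set, since every step deletes an element as long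
    as there is one. *)
Lemma names_shrink T : T \in names G -> shrink T \in names G.
Proof.
have small T' : #|T'| <= 1 -> shrink T' \in names G.
  move=> T'1; suff /eqP-> : shrink T' == set0 by apply: names0.
  by rewrite -cards_eq0 card_shrink; case: #|T'| T'1 => [|[]].
move=> NT; rewrite !in_setU in_set1 in NT.
case/orP: NT => [/orP[/eqP->|/imsetP[x _ ->]]|].
- by apply: small; rewrite cards0.
- by apply: small; rewrite cards1.
case/bigcupP=> i Gi /imsetP[k _ ->]; have [k_lt | k_ge] := ltnP k #|i.1|.
  rewrite inE; apply/orP; right; apply/bigcupP; exists i => //.
  by apply/imsetP; exists (Ordinal (k_lt : k.+1 < #|i.1|.+1)).
have card_iter n : #|iter n shrink i.1| = #|i.1| - n.
  by elim: n => [|n IHn] /=; rewrite ?subn0 // card_shrink IHn subnS.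
by apply: small; rewrite card_iter (eqP k_ge).
Qed.

Lemma card_names : #|names G| <= (1 + #|X| + \sum_(i in G) (#|i.1| + 1)).
Proof.
apply: leq_trans (leq_card_setU _ _) _; apply: leq_add.
  apply: leq_trans (leq_card_setU _ _) _; rewrite cards1 leq_add2l.
  exact: leq_imset_card.
apply: (@leq_trans (\sum_(i in G) #|chain i.1|)).
  elim/big_rec2: _ => [|i n B _ IH]; first by rewrite cards0.
  by apply: leq_trans (leq_card_setU _ _) _; rewrite leq_add2l.
apply: leq_sum => i _; rewrite addn1; apply: leq_trans (leq_imset_card _ _) _.
by rewrite cardT size_enum_ord.
Qed.

(** [None] is the vertex that implies all others. *)
Definition node_type := option {T : {set X} | T \in names G}.

Lemma card_node_type : #|{: node_type}| = #|names G|.+1.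
Proof.
by rewrite card_option card_sig; congr _.+1; apply: eq_card => T; rewrite !inE.
Qed.

(** Only names are meant: any other set goes to the default [None]. *)
Definition node T : node_type := insub T.

Definition holds S (u : node_type) :=
  if u is Some T then val T \subset S else false.

Lemma holds_node S T : T \in names G -> holds S (node T) = (T \subset S).
Proof. by move=> NT; rewrite /node insubT. Qed.

(** The families make, in this order: the vertices doubled, [None] imply all of
    them, each name imply its two parts and follow from both together, each conclusion
    follow from its premise, and the empty name true. *)
Definition encoding : {set {set node_type * bool}} :=
  [set arrow u u | u : node_type]
  :|: [set arrow None u | u : node_type]
  :|: [set arrow (node T) (node (shrink T)) | T in names G]
  :|: [set arrow (node T) (node (residue T)) | T in names G]
  :|: [set meet_edge (node (shrink T)) (node (residue T)) (node T)
        | T in names G]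
  :|: [set arrow (node i.1) (node [set i.2]) | i in G]
  :|: [set [set (node set0, false)]].

Lemma card_encoding : #|encoding| <= 5 * #|names G| + #|G| + 3.
Proof.
have -> : 5 * #|names G| + #|G| + 3 = #|{: node_type}| + #|{: node_type}|
    + #|names G| + #|names G| + #|names G| + #|G| + 1.
  by rewrite card_node_type; lia.
do 6!(apply: leq_trans (leq_card_setU _ _) _; apply: leq_add;
      last by [apply: leq_imset_card | rewrite cards1]).
exact: leq_imset_card.
Qed.

Lemma encodingP E :
  E \in encoding ->
  [\/ exists u w, E = arrow u w, exists a b c, E = meet_edge a b c
    | E = [set (node set0, false)]].
Proof.
rewrite !in_setU in_set1 => /orP[|/eqP]; last by constructor 3.
case/orP=> [|/imsetP[i _ ->]]; last by constructor 1; do 2!eexists.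
case/orP=> [|/imsetP[T _ ->]]; last by constructor 2; do 3!eexists.
case/orP=> [|/imsetP[T _ ->]]; last by constructor 1; do 2!eexists.
case/orP=> [|/imsetP[T _ ->]]; last by constructor 1; do 2!eexists.
by case/orP=> /imsetP[u _ ->]; constructor 1; do 2!eexists.
Qed.

Lemma encoding_normalized : normalized_hypergraph encoding.
Proof.
apply/negP=> /encodingP[[u [w]]|[a [b [c]]]|] /setP.
- by move=> /(_ (u, false)); rewrite !inE eqxx.
- by move=> /(_ (a, false)); rewrite !inE eqxx.
by move=> /(_ (node set0, false)); rewrite !inE eqxx.
Qed.

Lemma card_encoding_edge E : E \in encoding -> #|E| <= 3.
Proof.
have le3 (v1 v2 v3 : node_type * bool) : #|[set v1; v2; v3]| <= 3.
  apply: leq_trans (leq_card_setU _ _) _; rewrite cards1 cards2.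
  by case: (v1 != v2).
by case/encodingP=> [[u [w ->]]|[a [b [c ->]]]|->]; rewrite ?le3 // cards1.
Qed.

Lemma encoding_rank : hypergraph_rank encoding <= 3.
Proof. by apply/bigmax_leqP => E; apply: card_encoding_edge. Qed.

(** With N names, the length is at most 2 (N + 1) + 4 (5 N + #|G| + 3), and
    N + #|G| is at most one more than the incidence length; so the constant 58
    suffices, and 60 is a round bound. *)
Lemma encoding_length :
  hypergraph_length encoding <= 60 * maxn 1 (incidence_length G).
Proof.
have cardV : #|{: node_type * bool}| = #|names G|.+1 * 2.
  by rewrite card_prod card_bool card_node_type.
have sum_edges : \sum_(E in encoding) #|E| <= #|encoding| * 3.
  by rewrite -sum_nat_const; apply: leq_sum => E; apply: card_encoding_edge.
rewrite /hypergraph_length cardV.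
have := card_names; have := card_encoding; rewrite /incidence_length; lia.
Qed.

Definition model_of S : {set node_type * bool} := doubled (holds S).

Definition set_of (M : {set node_type * bool}) : {set X} :=
  [set x | (node [set x], false) \in M].

Lemma model_of_mono : {mono model_of : S S' / S \subset S'}.
Proof.
move=> S S'; apply/subsetP/subsetP=> [sub x Sx | sub [[T|] b]]; rewrite ?inE //=.
  have := sub (node [set x], false).
  by rewrite !inE !holds_node ?names1 // !sub1set; apply.
by move/subset_trans; apply; apply/subsetP.
Qed.

Lemma model_ofK : cancel model_of set_of.
Proof.
by move=> S; apply/setP=> x; rewrite !inE holds_node ?names1 // sub1set.
Qed.

Lemma model_of_proper S :
  S \in models G -> model_of S \in proper_models encoding.
Proof.
rewrite inE => /forall_inP modS; rewrite in_setD1; apply/andP; split.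
  by apply/eqP=> /setP/(_ (None, false)); rewrite !inE.
apply/horn_modelsP=> E; rewrite !in_setU in_set1 => /orP[|/eqP->].
  case/orP=> [|/imsetP[i Gi ->] v]; last first.
    apply: doubled_arrow; rewrite !holds_node ?names1 ?names_premise // sub1set.
    by move: (modS i Gi); apply/implyP.
  case/orP=> [|/imsetP[T NT ->] v]; last first.
    apply: doubled_meet_edge; rewrite !holds_node ?names_shrink ?names_residue //.
    by rewrite -subUset shrinkU_residue.
  case/orP=> [|/imsetP[T NT ->] v]; last first.
    apply: doubled_arrow; rewrite !holds_node ?names_residue //.
    exact/subset_trans/subsetDl.
  case/orP=> [|/imsetP[T NT ->] v]; last first.
    apply: doubled_arrow; rewrite !holds_node ?names_shrink //.
    exact/subset_trans/shrink_sub.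
  by case/orP=> /imsetP[u _ ->] v; apply: doubled_arrow.
by move=> v /set1P-> _; rewrite inE holds_node ?names0 ?sub0set.
Qed.

Section Decoding.

Variable M : {set node_type * bool}.
Hypothesis properM : M \in proper_models encoding.

Let modM : M \in models (horn_cnf encoding).
Proof. by case/setD1P: properM. Qed.

Lemma mem_twin u b : ((u, b) \in M) = ((u, false) \in M).
Proof.
case: b => //; apply: (twins_model modM).
by rewrite !in_setU (imset_f (fun u => arrow u u)).
Qed.

Lemma arrow_mem u w :
  arrow u w \in encoding -> (u, false) \in M -> (w, false) \in M.
Proof. by move=> Huw uM; apply: (arrow_model modM Huw uM); rewrite mem_twin. Qed.

Lemma top_notin_model : (None, false) \notin M.
Proof.
apply/negP=> topM; case/setD1P: properM => /eqP[]; apply/setP=> -[u b].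
rewrite mem_twin in_setT; apply: arrow_mem topM.
by rewrite !in_setU (imset_f (arrow None)) ?orbT.
Qed.

(** Induction on T: the edges at T say that T is in the model exactly when
    [shrink T] and [residue T] are, and [residue T] is a singleton unless T is
    empty. *)
Lemma mem_node_model T :
  T \in names G -> ((node T, false) \in M) = (T \subset set_of M).
Proof.
have [n] := ubnP #|T|; elim: n T => // n IH T lt_Tn NT.
have [-> | T_neq0] := eqVneq T set0.
  rewrite sub0set; apply: (horn_modelsP _ _ modM [set (node set0, false)]).
  - by rewrite !inE eqxx orbT.
  - by rewrite inE.
  by rewrite setDv sub0set.
have lt_shrink : #|shrink T| < #|T|.
  by rewrite card_shrink prednK // card_gt0.
have shrinkE := IH _ (leq_trans lt_shrink lt_Tn) (names_shrink NT).
have residueE : ((node (residue T), false) \in M) = (residue T \subset set_of M).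
  case: (residueP T) => [T0 | [x ->]]; last by rewrite sub1set inE.
  have := shrinkU_residue T; rewrite T0 setU0.
  by move/(congr1 (fun S => #|S|)); lia.
rewrite -[in RHS](shrinkU_residue T) subUset -shrinkE -residueE.
apply/idP/andP=> [TM | [sM rM]].
  split; apply: arrow_mem TM; rewrite !in_setU.
  - by rewrite (imset_f (fun T => arrow (node T) (node (shrink T)))) ?orbT.
  by rewrite (imset_f (fun T => arrow (node T) (node (residue T)))) ?orbT.
rewrite -(mem_twin _ true); apply: (meet_edge_model modM _ sM rM).
by rewrite !in_setU (imset_f (fun T =>
  meet_edge (node (shrink T)) (node (residue T)) (node T))) ?orbT.
Qed.

Lemma set_of_model : set_of M \in models G.
Proof.
rewrite inE; apply/forall_inP=> i Gi; apply/implyP.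
rewrite -mem_node_model ?names_premise // inE; apply: arrow_mem.
by rewrite !in_setU (imset_f (fun i : implication X =>
  arrow (node i.1) (node [set i.2]))) ?orbT.
Qed.

Lemma set_ofK : model_of (set_of M) = M.
Proof.
apply/setP=> -[[t|] b]; rewrite inE mem_twin /=; last first.
  by rewrite (negPf top_notin_model).
by have := mem_node_model (valP t); rewrite /node valK => <-.
Qed.

End Decoding.

Lemma encoding_isomorphic :
  poset_isomorphic (@inclusion X (models G))
                   (@inclusion _ (proper_models encoding)).
Proof.
apply: (@members_isomorphic _ _ _ _ model_of set_of) => [S|M|S _|M|S S' _ _].
- exact: model_of_proper.
- exact: set_of_model.
- exact: model_ofK.
- exact: set_ofK.
exact: model_of_mono.
Qed.

End Encoding.

(** * Finite lattices *)

(** Take all valid implications.  If M obeys them, then M is its own closure: an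
    element b of the closure outside M would make M -> b a valid one. *)
Lemma closure_system_basis (X : finType) (C : {set {set X}}) :
  closure_system C ->
  exists2 G : {set implication X}, normalized_basis G & C = models G.
Proof.
move=> [CT CI].
exists [set i : implication X | (i.2 \notin i.1)
          && [forall S in C, (i.1 \subset S) ==> (i.2 \in S)]].
  by move=> i; rewrite inE => /andP[].
apply/setP=> M; rewrite inE; apply/idP/forall_inP=> [CM i | modM].
  by rewrite inE => /andP[_ /forall_inP]; apply.
pose cl := \bigcap_(S in C | M \subset S) S.
have Ccl : cl \in C.
  by rewrite /cl; elim/big_ind: _ => // S /andP[].
suff <- : cl = M by [].
apply/eqP; rewrite eqEsubset; apply/andP; split; last first.
  by apply/bigcapsP=> S /andP[].
apply/subsetP=> b /bigcapP clb; apply/negPn/negP=> nMb.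
case/negP: (nMb); move: (modM (M, b)); rewrite inE /= nMb subxx; apply.
by apply/forall_inP=> S CS; apply/implyP=> MS; apply: clb; rewrite CS.
Qed.

Section PrincipalIdeals.

Import Order.LTheory.

Variables (d : Order.disp_t) (L : finLatticeType d).
Implicit Types x y : L.

Definition principal_ideal x : {set L} := [set y | (y <= x)%O].

Lemma principal_ideal_mono :
  {mono principal_ideal : x y / (x <= y)%O >-> x \subset y}.
Proof.
move=> x y; apply/subsetP/idP=> [/(_ x) | xy z]; rewrite !inE ?lexx; first exact.
by move/le_trans; apply.
Qed.

Lemma principal_ideal_inj : injective principal_ideal.
Proof.
move=> x y eq_xy; apply: le_anti.
by rewrite -!principal_ideal_mono eq_xy subxx.
Qed.

(** The full set is principal because a nonempty finite lattice has a top. *)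
Lemma principal_ideals_closure_system (x0 : L) :
  closure_system [set principal_ideal x | x : L].
Proof.
split=> [|_ _ /imsetP[x _ ->] /imsetP[y _ ->]].
  (* The join of all elements is the top; x0 serves to start it. *)
  pose top := foldr Order.join x0 (enum L).
  suff -> : [set: L] = principal_ideal top by apply: imset_f.
  apply/setP=> y; rewrite !inE /top; apply/esym.
  have: y \in enum L by rewrite mem_enum.
  elim: (enum L) => //= z s IH; rewrite inE => /predU1P[<-|/IH le_y].
    by rewrite leUl.
  by rewrite (le_trans le_y) // leUr.
apply/imsetP; exists (Order.meet x y) => //; apply/setP=> z.
by rewrite !inE lexI.
Qed.

Lemma principal_ideals_isomorphic :
  poset_isomorphic (<=%O : rel L)
                   (@inclusion L [set principal_ideal x | x : L]).
Proof.
pose f x : members [set principal_ideal x | x : L] :=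
  exist _ (principal_ideal x) (imset_f principal_ideal (isT : x \in L)).
exists f; last exact: principal_ideal_mono.
apply: inj_card_bij => [x y /(congr1 val) /principal_ideal_inj //|].
rewrite card_sig -(card_imset predT principal_ideal_inj); apply: eq_leq.
by apply: eq_card => S; rewrite !inE.
Qed.

End PrincipalIdeals.

(** This covers the lattice with empty carrier: on an empty ground set the only
    vertex set is the full one, so that there is no proper model. *)
Lemma empty_poset_isomorphic (T : Type) (leT : rel T) :
  (T -> False) ->
  poset_isomorphic leT (@inclusion void (proper_models set0)).
Proof.
move=> T0.
have noM (M : members (proper_models (set0 : {set {set void}}))) : False.
  by case: M => M /setD1P[/eqP[]]; apply/setP; case.
exists (fun x => False_rect _ (T0 x)); last by move=> x; case: (T0 x).
exists (fun M => False_rect _ (noM M)) => [x|M]; first by case: (T0 x).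
by case: (noM M).
Qed.

(* O(.) is read with an absolute constant c.  The "maxn 1" matters only for
   X empty: there the incidence length is 0, while any suitable H has a
   nonempty ground set. *)
Theorem corollary3p13 :
  (exists c : nat,
     forall (X : finType) (C : {set {set X}}) (G : {set implication X}),
       closure_system C -> normalized_basis G -> C = models G ->
       exists (V : finType) (H : {set {set V}}),
         [/\ normalized_hypergraph H,
             hypergraph_rank H <= 3,
             poset_isomorphic (@inclusion X C) (@inclusion V (proper_models H))
           & hypergraph_length H <= c * maxn 1 (incidence_length G)])
  /\
  (forall (d : Order.disp_t) (L : finLatticeType d),
     exists (V : finType) (H : {set {set V}}),
       hypergraph_rank H <= 3 /\
       poset_isomorphic (<=%O : rel L) (@inclusion V (proper_models H))).
Proof.
split=> [|d L].
  exists 60 => X C G _ _ ->; exists (node_type G * bool)%type, (encoding G).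
  split; [exact: encoding_normalized | exact: encoding_rank | |].
    exact: encoding_isomorphic.
  exact: encoding_length.
have [x0 _ | L0] := pickP (predT : pred L); last first.
  exists void, set0; split; first by rewrite /hypergraph_rank big_set0.
  by apply: empty_poset_isomorphic => x; have := L0 x.
have [G _ eqG] := closure_system_basis (principal_ideals_closure_system x0).
exists (node_type G * bool)%type, (encoding G).
split; first exact: encoding_rank.
apply: poset_isomorphic_trans (principal_ideals_isomorphic L) _.
by rewrite eqG; apply: encoding_isomorphic.
Qed.
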